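(* Let $P\in\mathbb{C}[X_0,X_1]_l\setminus\{0\}$ and $0\le d\le l$. (1) We have $$\dim(C_P^d)=\begin{cases}0&\text{if } l+2-\mathrm{crank}(P)\le d\le l,\\ l-d+1-\mathrm{crank}(P)&\text{if }\mathrm{crank}(P)\le d<l+2-\mathrm{crank}(P),\\ l-2d&\text{if } d<\mathrm{crank}(P).\end{cases}$$ (2) The dimension $s:=\dim(C^d_P)$ depends only on $d$ and the cactus rank $r=\mathrm{crank}(P)$: (a) For $0\le d\le[\frac{l}{2}]$, the function $s=s(r)$ is given by $s(r)=l-d-(r-1)$ if $1\le r\le d+1$, and $s(r)=l-2d$ if $d+1\le r\le[\frac{l}{2}]+1$. (b) For $[\frac{l}{2}]\le d\le l$, the function $s=s(r)$ is given by $s(r)=l-d-(r-1)$ if $1\le r\le l-d+1$, and $s(r)=0$ if $l-d+1\le r\le[\frac{l}{2}]+1$.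
   Context: $\mathbb{C}[X_0,X_1]_k$ is the space of homogeneous polynomials of degree $k$. For $Q\in\mathbb{C}[\xi_0,\xi_1]$ and $P\in\mathbb{C}[X_0,X_1]$ put $Q\bullet P:=Q(\frac{\partial}{\partial X_0},\frac{\partial}{\partial X_1})(P)$, and $\mathrm{Ann}(P)=\{Q\in\mathbb{C}[\xi_0,\xi_1]\mid Q\bullet P=0\}$ (the apolar ideal). For $P\in\mathbb{C}[X_0,X_1]_l$ and $0\le d\le l$, $$C^d_P:=\mathrm{coker}\big(\mathbb{C}[\xi_0,\xi_1]_d\ni Q\mapsto Q\bullet P\in\mathbb{C}[X_0,X_1]_{l-d}\big).$$ The cactus rank $\mathrm{crank}(P)$ of a non-trivial binary form $P$ is the minimal length of a $0$-dimensional subscheme $Z\subset\mathbb{P}^1_{\mathbb{C}}$ defined by a homogeneous saturated ideal $I_Z$ contained in $\mathrm{Ann}(P)$. $[x]$ denotes the integer part of $x$. *)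

(* Defs.v *)
From HB Require Import structures.
From mathcomp Require Import all_boot all_order all_algebra ring_quotient.
From mathcomp Require Import boolp.
From mathcomp Require Import ssrcomplements mpoly.

Set Implicit Arguments.
Unset Strict Implicit.
Unset Printing Implicit Defensive.

Import GRing.Theory.
Local Open Scope ring_scope.

Section QuotientSpace.
Context (K : fieldType) (V : vectType K).
Implicit Types U : {vspace V}.

(* MathComp has no quotient of a vector space by a subspace: V / U is realized
   on the complement U^C, with projection quotv_pi U, which is onto and has
   kernel U. *)
Definition quotv U : vectType K := subvs_of (U^C)%VS.

Definition quotv_pi U : 'Hom(V, quotv U) :=
  (linfun (vsproj (U^C)%VS) \o (\1 - projv U))%VF.

Lemma quotv_piE U v : vsval (quotv_pi U v) = v - projv U v.
Proof.
rewrite /quotv_pi comp_lfunE lfunE /= vsprojK add_lfunE opp_lfunE id_lfunE //.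
exact: memv_projC.
Qed.

Lemma lker_quotv_pi U : lker (quotv_pi U) = U.
Proof.
apply/vspaceP=> v; rewrite memv_ker; apply/eqP/idP=> [pv0|vU].
  have /eqP := congr1 vsval pv0; rewrite quotv_piE linear0 subr_eq0.
  by move/eqP->; exact: memv_proj.
by apply: val_inj; rewrite /= quotv_piE projv_id // subrr.
Qed.

Lemma limg_quotv_pi U : limg (quotv_pi U) = fullv.
Proof.
apply/vspaceP=> w; rewrite memvf; apply/memv_imgP.
exists (vsval w); rewrite ?memvf //; apply: val_inj; rewrite /= quotv_piE.
have : vsval w \in lker (projv U) by rewrite lker_proj; exact: subvsP.
by rewrite memv_ker => /eqP->; rewrite subr0.
Qed.

Definition coker (W : vectType K) (f : 'Hom(W, V)) : vectType K :=
  quotv (limg f).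

End QuotientSpace.

Section Apolarity.
Context (K : fieldType).

(* Both K[X_0, X_1] and its dual ring K[xi_0, xi_1] are {mpoly K[2]}; Q^`M[m]
   differentiates m i times in X_i. *)
Definition apolar (Q P : {mpoly K[2]}) : {mpoly K[2]} :=
  \sum_(m <- msupp Q) Q@_m *: P^`M[m].

Local Notation "Q • P" := (apolar Q P) (at level 40, no associativity).

Definition Ann (P : {mpoly K[2]}) : {pred {mpoly K[2]}} :=
  [pred Q | Q • P == 0].

Lemma apolarwE k (Q P : {mpoly K[2]}) : (msize Q <= k)%N ->
  Q • P = \sum_(m : 'X_{1..2 < k}) Q@_m *: P^`M[m].
Proof.
move=> leQk; rewrite /apolar (big_mksub 'X_{1..2 < k}) //=; first last.
- by move=> m /msize_mdeg_lt /leq_trans; apply.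
- exact: msupp_uniq.
rewrite big_rmcond //= => m /memN_msupp_eq0 ->; exact: scale0r.
Qed.

Lemma apolar_linear (P : {mpoly K[2]}) : linear (fun Q => Q • P).
Proof.
move=> c Q1 Q2; pose k := maxn (msize (c *: Q1 + Q2)) (maxn (msize Q1) (msize Q2)).
rewrite !(@apolarwE k) ?leq_max ?leqnn ?orbT //.
rewrite scaler_sumr -big_split /=; apply: eq_bigr => m _.
by rewrite mcoeffD mcoeffZ scalerDl scalerA.
Qed.

Lemma dhomog_apolar d l (Q P : {mpoly K[2]}) :
  Q \is d.-homog -> P \is l.-homog -> Q • P \is (l - d)%N.-homog.
Proof.
move=> /dhomogP homQ /dhomogP homP; rewrite /apolar big_seq.
apply: rpred_sum => m /homQ /= degm; apply: rpredZ.
apply/dhomogP => m' /=; rewrite mcoeff_msupp mcoeff_mderivm => nz.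
have : (m + m')%MM \in msupp P.
  by rewrite mcoeff_msupp; apply: contraNneq nz => ->; rewrite mul0rn.
by move=> /homP /=; rewrite mdegD degm => <-; rewrite addKn.
Qed.

Section Cokernel.
Context (l : nat) (P : dhomog 2 K l) (d : nat).

Definition apolar_map (Q : dhomog 2 K d) : dhomog 2 K (l - d) :=
  DHomog (dhomog_apolar (dhomog_is_dhomog Q) (dhomog_is_dhomog P)).

Lemma apolar_map_linear : linear apolar_map.
Proof. by move=> c Q1 Q2; apply: val_inj; exact: apolar_linear. Qed.

HB.instance Definition _ :=
  GRing.isLinear.Build K (dhomog 2 K d) (dhomog 2 K (l - d)) _ apolar_map
    apolar_map_linear.

(* The space C^d_P; it is meaningful for d <= l. *)
Definition apolar_coker : vectType K := coker (linfun apolar_map).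

End Cokernel.

Implicit Types I : {pred {mpoly K[2]}}.

Definition homogeneous I : Prop :=
  forall Q, Q \in I -> forall k, pihomog mdeg k Q \in I.

(* I contains every Q such that m^n Q is in I for some n, where m is the
   irrelevant ideal; m^n is generated by the forms of degree n. *)
Definition saturated I : Prop :=
  forall Q, (exists n, forall M, M \is n.-homog -> M * Q \in I) -> Q \in I.

Definition graded_piece I k (W : {vspace dhomog 2 K k}) : Prop :=
  forall Q : dhomog 2 K k, (Q \in W) = ((Q : {mpoly K[2]}) \in I).

Definition hilbert_fun I k n : Prop :=
  exists2 W : {vspace dhomog 2 K k}, graded_piece I W & \dim {: quotv W} = n.

(* The Hilbert polynomial of a homogeneous ideal I is the constant n, i.e. the
   subscheme of P^1 it defines is 0-dimensional (or empty, if n = 0) of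
   length n. *)
Definition scheme_length I n : Prop :=
  exists k0, forall k, (k0 <= k)%N -> hilbert_fun I k n.

(* idealr_closed asks for a proper ideal, which for saturated ideals means that
   the subscheme is not empty. *)
Definition apolar_scheme (P : {mpoly K[2]}) n : Prop :=
  exists I, [/\ idealr_closed I, homogeneous I, saturated I,
                {subset I <= Ann P} & scheme_length I n].

(* The default value 0 is never reached: for N > 0 larger than the degree of P,
   xi_0^N generates an ideal as required, of length N. *)
Definition crank (P : {mpoly K[2]}) : nat :=
  match pselect (exists n, `[< apolar_scheme P n >]) with
  | left ex => ex_minn ex
  | right _ => 0%N
  end.

End Apolarity.

(* Main.v *)
(* Let r be the least degree of a nonzero form F in Ann(P).

   Up to factorials, Q |-> Q • P on forms of degree d is a Hankel matrix whose
   transpose is the matrix for l - d, so both have the same rank rho(d). For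
   d < r it is d + 1 by minimality, hence rho(d) = l - d + 1 for d > l - r. In
   particular, for D = l - r + 1, dim Ann(P)_D = D - r + 1 and Ann(P)_D consists
   of the multiples of F. If Q in Ann(P) has degree d <= D, then F divides X_0^(D-d) Q
   and X_1^(D-d) Q, hence Q; this gives rho(d) = r for r <= d <= D.

   The number r is the cactus rank. The ideal (F) is saturated and defines a
   scheme of length r. Conversely, let I be a saturated ideal with I_k of
   codimension n for all large k, and dehomogenize I_k to a space W of univariate
   polynomials. As I_(k+1) has codimension n too, dim(W + xW) <= dim W + 1, which
   forces W to contain h, x h, ..., x^(m-1) h for some h != 0, where m = dim W.
   So h has degree at most n, and the form of degree n obtained from h is in I
   by saturation. *)
Require Import Defs.
From HB Require Import structures.
From mathcomp Require Import all_boot all_order all_algebra ring_quotient.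
From mathcomp Require Import boolp zify.
From mathcomp Require Import reals mpoly complex.

Set Implicit Arguments.
Unset Strict Implicit.
Unset Printing Implicit Defensive.

Import Order.TTheory GRing.Theory Num.Theory.
Local Open Scope ring_scope.

(** * Binary forms, univariate polynomials and row vectors *)

Definition mnm2 (i j : nat) : 'X_{1..2} :=
  [multinom if k == ord0 then i else j | k < 2].

Lemma mdeg_mnm2 i j : mdeg (mnm2 i j) = (i + j)%N.
Proof. by rewrite mdegE !big_ord_recl big_ord0 !mnmE addn0. Qed.

Lemma mnm2D i j i' j' : (mnm2 i j + mnm2 i' j')%MM = mnm2 (i + i') (j + j').
Proof. by apply/mnmP=> k; rewrite !mnmE; case: ifP. Qed.

Lemma mnm2_eta (m : 'X_{1..2}) : m = mnm2 (m ord0) (mdeg m - m ord0).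
Proof.
apply/mnmP=> k; rewrite mnmE mdegE !big_ord_recl big_ord0 addn0 addKn.
case: eqP => [->//|/eqP]; case: k => [[|[|//]] hk] //= _.
by congr (m _); apply: val_inj.
Qed.

Lemma mnm2_inj i j i' j' : mnm2 i j = mnm2 i' j' -> i = i'.
Proof. by move/mnmP/(_ ord0); rewrite !mnmE. Qed.

Section Dehomogenization.
Context (K : fieldType).
Implicit Types (Q : {mpoly K[2]}) (p : {poly K}).

Definition dehom : {mpoly K[2]} -> {poly K} :=
  mmap (@polyC K) (fun i : 'I_2 => if i == ord0 then 'X else 1).

HB.instance Definition _ := GRing.RMorphism.on dehom.

(** Dropping the coefficients beyond degree [d] makes this linear on all of [{poly K}]; it inverts
    [dehom] on sizes up to [d.+1] only. *)
Definition rehom d p : {mpoly K[2]} :=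
  \sum_(i < d.+1) p`_i *: 'X_[mnm2 i (d - i)].

Lemma rehom_dhomog d p : rehom d p \is d.-homog.
Proof.
apply: rpred_sum => i _; apply: rpredZ; rewrite dhomogX /= mdeg_mnm2 subnKC //.
by rewrite -ltnS.
Qed.

Lemma rehom_is_linear d : linear (rehom d).
Proof.
move=> c p q; rewrite /rehom scaler_sumr -big_split /=; apply: eq_bigr => i _.
by rewrite coefD coefZ scalerDl scalerA.
Qed.
HB.instance Definition _ d :=
  GRing.isLinear.Build K {poly K} {mpoly K[2]} _ (rehom d) (rehom_is_linear d).

Lemma mcoeff_rehom d p i j : (i + j)%N = d -> (rehom d p)@_(mnm2 i j) = p`_i.
Proof.
move=> <-; rewrite /rehom raddf_sum /=.
have lti : (i < (i + j).+1)%N by rewrite ltnS leq_addr.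
rewrite (bigD1 (Ordinal lti)) //= mcoeffZ mcoeffX addKn eqxx mulr1 big1 ?addr0 //.
move=> k nek; rewrite mcoeffZ mcoeffX; case: eqP => [/mnm2_inj e|]; last by rewrite mulr0.
by case/eqP: nek; apply: val_inj.
Qed.

Lemma dehomX i j : dehom 'X_[mnm2 i j] = 'X^i.
Proof.
by rewrite /dehom mmapX /mmap1 !big_ord_recl big_ord0 !mnmE /= expr1n !mulr1.
Qed.

Lemma dehomZ c Q : dehom (c *: Q) = c *: dehom Q.
Proof. by rewrite -!mul_mpolyC rmorphM /= /dehom mmapC mul_polyC. Qed.

Lemma rehomK d p : (size p <= d.+1)%N -> dehom (rehom d p) = p.
Proof.
move=> sp; rewrite /rehom raddf_sum /=.
rewrite (eq_bigr (fun i : 'I_d.+1 => p`_i *: 'X^i)); last first.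
  by move=> i _; rewrite dehomZ dehomX.
apply/polyP=> i; rewrite -(poly_def d.+1 (fun i => p`_i)) coef_poly.
by case: ltnP => // ltdi; rewrite nth_default // (leq_trans sp).
Qed.

Definition homog_coefs d Q : {poly K} := \poly_(i < d.+1) Q@_(mnm2 i (d - i)).

Lemma homog_coefsK d Q : Q \is d.-homog -> rehom d (homog_coefs d Q) = Q.
Proof.
move=> homQ; apply/mpolyP=> m; case: (mdeg m =P d) => [eqd|/eqP nem].
  have le0 : (m ord0 <= d)%N by rewrite -eqd mdegE big_ord_recl leq_addr.
  have -> : m = mnm2 (m ord0) (d - m ord0) by rewrite -eqd -mnm2_eta.
  rewrite mcoeff_rehom; last by rewrite subnKC.
  by rewrite /homog_coefs coef_poly ltnS le0.
by rewrite !(dhomog_nemf_coeff _ nem) //; exact: rehom_dhomog.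
Qed.

Lemma dehomE d Q : Q \is d.-homog -> dehom Q = homog_coefs d Q.
Proof. by move=> /homog_coefsK {1}<-; rewrite rehomK // size_poly. Qed.

Lemma size_dehom d Q : Q \is d.-homog -> (size (dehom Q) <= d.+1)%N.
Proof. by move=> /dehomE ->; exact: size_poly. Qed.

Lemma dehomK d Q : Q \is d.-homog -> rehom d (dehom Q) = Q.
Proof. by move=> homQ; rewrite (dehomE homQ) homog_coefsK. Qed.

Lemma coef_dehom d Q i j :
  Q \is d.-homog -> (i + j)%N = d -> (dehom Q)`_i = Q@_(mnm2 i j).
Proof. by move=> homQ eqd; rewrite -(mcoeff_rehom _ eqd) dehomK. Qed.

Lemma dehom_inj d Q1 Q2 :
  Q1 \is d.-homog -> Q2 \is d.-homog -> dehom Q1 = dehom Q2 -> Q1 = Q2.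
Proof. by move=> h1 h2 eq12; rewrite -(dehomK h1) eq12 dehomK. Qed.

Lemma dehom_eq0 d Q : Q \is d.-homog -> (dehom Q == 0) = (Q == 0).
Proof.
move=> h; apply/eqP/eqP => [|->]; last exact: rmorph0.
by move=> e; apply: (dehom_inj h (rpred0 _)); rewrite rmorph0.
Qed.
End Dehomogenization.

Section FormVector.
Context (K : fieldType) (d : nat).

Definition form_of_row (v : 'rV[K]_d.+1) : dhomog 2 K d :=
  DHomog (rehom_dhomog d (rVpoly v)).

Lemma form_of_row_is_linear : linear form_of_row.
Proof. by move=> c u v; apply: val_inj; rewrite /= !linearP. Qed.
HB.instance Definition _ :=
  GRing.isLinear.Build K 'rV[K]_d.+1 (dhomog 2 K d) _ form_of_row form_of_row_is_linear.

Definition row_of_form (Q : dhomog 2 K d) : 'rV[K]_d.+1 := poly_rV (dehom Q).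

Lemma row_of_formK : cancel row_of_form form_of_row.
Proof.
move=> Q; apply: val_inj; have hQ := dhomog_is_dhomog Q.
by rewrite /= poly_rV_K ?size_dehom // dehomK.
Qed.

Lemma form_of_rowK : cancel form_of_row row_of_form.
Proof. by move=> v; rewrite /row_of_form /= rehomK ?size_poly // rVpolyK. Qed.

Lemma dim_dhomog2 : \dim {: dhomog 2 K d} = d.+1.
Proof. by rewrite dimvf /dim /= addn1 binSn. Qed.
End FormVector.

Lemma dimv_param (K : fieldType) (V : vectType K) n (g : {linear 'rV[K]_n -> V})
    (U : {vspace V}) :
  injective g -> (forall v, reflect (exists w, v = g w) (v \in U)) -> \dim U = n.
Proof.
move=> injg inU; have -> : U = limg (linfun g).
  apply/vspaceP=> v; apply/inU/memv_imgP => [[w ->]|[w _ ->]]; exists w.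
  - exact: memvf.
  - by rewrite lfunE.
  - by rewrite lfunE.
rewrite limg_dim_eq ?dimvf ?dim_matrix; first exact: mul1n.
apply/eqP; rewrite capfv; apply/lker0P => u v; rewrite !lfunE; exact: injg.
Qed.

(** * Apolar maps as Hankel matrices *)

Section Catalecticant.
Context (K : numFieldType).
Implicit Types (P Q : {mpoly K[2]}).

Definition hankel (a : nat -> K) m n : 'M[K]_(m, n) := \matrix_(i, j) a (i + j)%N.

Lemma rank_hankelC a m n : \rank (hankel a m n) = \rank (hankel a n m).
Proof.
rewrite -mxrank_tr; congr (\rank _).
by apply/matrixP=> i j; rewrite !mxE addnC.
Qed.

Definition contract P Q := apolar Q P.

HB.instance Definition _ P :=
  GRing.isLinear.Build K {mpoly K[2]} {mpoly K[2]} _ (contract P) (apolar_linear P).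

Lemma contractX P m : contract P 'X_[m] = P^`M[m].
Proof. by rewrite /contract /apolar msuppX big_seq1 mcoeffX eqxx scale1r. Qed.

(* The factorials turn P into the functional Q |-> Q • P on forms of its own degree. *)
Definition moment l P k : K := P@_(mnm2 k (l - k)) * (k`! * (l - k)`!)%:R.

(** Differentiation produces falling factorials, which j! and j'! complete to (i+j)! and (l-(i+j))!.
    The weights then depend on i + j alone, as in a Hankel matrix. *)
Lemma mcoeff_contract l d P Q j j' :
  Q \is d.-homog -> (d + (j + j'))%N = l ->
  (contract P Q)@_(mnm2 j j') * (j`! * j'`!)%:R =
    \sum_(i < d.+1) (dehom Q)`_i * moment l P (i + j).
Proof.
move=> homQ eql; rewrite -{1}(dehomK homQ) /rehom.
rewrite [contract P _]linear_sum raddf_sum /=  mulr_suml; apply: eq_bigr => i _.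
rewrite linearZ /= contractX mcoeffZ mcoeff_mderivm mnm2D -mulrA; congr (_ * _).
have led : (i <= d)%N by rewrite -ltnS.
have -> : (d - i + j')%N = (l - (i + j))%N by lia.
rewrite !big_ord_recl big_ord0 !mnmE muln1 /= /moment.
rewrite mulrnAl -mulrnAr -mulrnA; congr (_ * _%:R).
have e1 : (i + j) ^_ i * j`! = (i + j)`!.
  by rewrite -(ffact_fact (leq_addr j i)) addKn.
have e2 : (l - (i + j)) ^_ (d - i) * j'`! = (l - (i + j))`!.
  have le2 : (d - i <= l - (i + j))%N by lia.
  have -> : j' = (l - (i + j) - (d - i))%N by lia.
  exact: ffact_fact.
by rewrite -e1 -e2 mulnC mulnACA.
Qed.

Section Ranks.
Context (l : nat) (P : dhomog 2 K l) (d : nat) (led : (d <= l)%N).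

Local Notation H := (hankel (moment l P) d.+1 (l - d).+1).

(** The entries of the product are the coefficients of Q • P times factorials, which are nonzero in
    characteristic 0. *)
Lemma annP (Q : dhomog 2 K d) :
  ((Q : {mpoly K[2]}) \in Ann P) = (row_of_form Q *m H == 0).
Proof.
have homQ := dhomog_is_dhomog Q.
have homQP := dhomog_apolar homQ (dhomog_is_dhomog P).
have entry (j : 'I_(l - d).+1) : (row_of_form Q *m H) 0 j =
    (apolar Q P)@_(mnm2 j (l - d - j)) * (j`! * (l - d - j)`!)%:R.
  rewrite -/(contract P Q) (@mcoeff_contract l d) //; last first.
    by have := ltn_ord j; lia.
  by rewrite mxE; apply: eq_bigr => i _; rewrite !mxE.
rewrite inE; apply/eqP/eqP => [QP0|vH0].
  by apply/rowP=> j; rewrite entry QP0 mcoeff0 mul0r mxE.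
apply/eqP; rewrite -(dehom_eq0 homQP); apply/eqP/polyP=> j; rewrite coef0.
case: (ltnP j (l - d).+1) => [ltj|gej]; last first.
  by rewrite nth_default // (leq_trans (size_dehom homQP)).
rewrite (coef_dehom homQP (j := l - d - j)); last by rewrite subnKC // -ltnS.
have := entry (Ordinal ltj); rewrite vH0 [LHS]mxE => /esym/eqP.
rewrite mulf_eq0 => /orP[/eqP //|].
by rewrite pnatr_eq0 gtn_eqF // muln_gt0 !fact_gt0.
Qed.

Lemma lker_apolar_map (Q : dhomog 2 K d) :
  (Q \in lker (linfun (@apolar_map K l P d))) = ((Q : {mpoly K[2]}) \in Ann P).
Proof. by rewrite memv_ker lfunE inE -val_eqE. Qed.

Lemma dim_lker_apolar : \dim (lker (linfun (@apolar_map K l P d))) = (d.+1 - \rank H)%N.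
Proof.
rewrite -mxrank_ker; set B := row_base (kermx H).
apply: (dimv_param (g := @form_of_row K d \o mulmxr B)).
  move=> u v /(can_inj (@form_of_rowK _ _)) /eqP.
  rewrite -subr_eq0 -mulmxBl mulmx_free_eq0 ?row_base_free // subr_eq0.
  by move/eqP.
move=> Q; rewrite lker_apolar_map annP.
have -> : (row_of_form Q *m H == 0) = (row_of_form Q <= B)%MS.
  by rewrite eq_row_base sub_kermx.
apply: (iffP submxP) => -[w eqw]; exists w.
  by rewrite /= -eqw row_of_formK.
by rewrite eqw /= form_of_rowK.
Qed.

Lemma dim_apolar_coker : \dim {: apolar_coker P d} = ((l - d).+1 - \rank H)%N.
Proof.
rewrite /apolar_coker /coker /quotv dimvf /dim /= dimv_compl dim_dhomog2.
congr (_ - _)%N; have := limg_ker_dim (linfun (@apolar_map K l P d)) fullv.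
rewrite capfv dim_lker_apolar dim_dhomog2.
(* [\rank H <= d.+1] makes the truncated subtraction in the kernel dimension exact. *)
by have := rank_leq_row H; lia.
Qed.
End Ranks.
End Catalecticant.

(** * The ideal of multiples of a form: homogeneity, saturation, length *)

Section PrincipalIdeals.
Context (K : fieldType).
Implicit Types (F G Q M : {mpoly K[2]}) (I : {pred {mpoly K[2]}}).

Lemma pihomog_mull r k F G : F \is r.-homog ->
  pihomog mdeg k (F * G) = if (r <= k)%N then F * pihomog mdeg (k - r) G else 0.
Proof.
move=> homF; pose N := maxn (msize G) (k - r).+1.
rewrite {1}(@pihomog_partitionE _ _ mdeg N G) ?leq_maxl // mulr_sumr linear_sum /=.
have term j : pihomog mdeg k (F * pihomog mdeg j G) =
    if (r + j == k)%N then F * pihomog mdeg j G else 0.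
  have homFG := dhomogM homF (pihomogP mdeg j G).
  by case: eqP => [<-|/eqP ne]; [rewrite pihomog_dE | rewrite (pihomog_ne0 ne)].
under eq_bigr => j _ do rewrite term.
rewrite -big_mkcond /=.
case: leqP => [lerk|ltkr]; last by rewrite big_pred0 // => j; lia.
have ltN : (k - r < N)%N by rewrite leq_max ltnSn orbT.
rewrite (big_pred1 (Ordinal ltN)) // => j /=.
by rewrite -val_eqE /=; lia.
Qed.

(* After dehomogenizing, Q = F B and 'X^n B = A for some B: as A has bounded
   degree, so has B, which is therefore the dehomogenization of a cofactor. *)
Lemma mull_descent r q n F Q A B :
  F \is r.-homog -> Q \is q.-homog -> F != 0 -> (r <= n + q)%N ->
  A \is (n + q - r).-homog -> 
  'X_[mnm2 n 0] * Q = F * A -> 'X_[mnm2 0 n] * Q = F * B ->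
  exists2 C, C \is (q - r).-homog & Q = F * C.
Proof.
move=> homF homQ nzF lern homA eqA eqB.
set f := dehom F; have nzf : f != 0 by rewrite (dehom_eq0 homF).
set b := dehom B.
have eQ : dehom Q = f * b by rewrite -rmorphM -eqB rmorphM /= dehomX mul1r.
have eb : 'X^n * b = dehom A.
  by apply: (mulfI nzf); rewrite -rmorphM -eqA rmorphM /= dehomX eQ mulrCA.
exists (rehom (q - r) b); first exact: rehom_dhomog.
have [b0|nzb] := eqVneq b 0.
  apply/eqP; rewrite b0 raddf0 mulr0 -(dehom_eq0 homQ) eQ b0 mulr0 //.
(* The degree of [A] bounds that of [b]; as [b] is nonzero this also forces [r <= q], so [q - r] is
   not truncated. *)
have := size_dehom homA; rewrite -eb mulrC size_mulXn // => sb.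
have sb0 : (0 < size b)%N by rewrite size_poly_gt0.
have leq : (r <= q)%N by lia.
apply: (dehom_inj homQ).
  by rewrite -(subnKC leq); apply: dhomogM => //; rewrite addKn; exact: rehom_dhomog.
by rewrite rmorphM /= rehomK ?eQ //; lia.
Qed.

Definition principal F : {pred {mpoly K[2]}} := [pred Q | `[< exists G, Q = F * G >]].

Lemma principalP F Q : reflect (exists G, Q = F * G) (Q \in principal F).
Proof. exact: asboolP. Qed.

(** Any cofactor can be replaced by its component of degree [q - r]; if [q < r], then Q = 0. *)
Lemma homog_principalP r q F Q : F \is r.-homog -> Q \is q.-homog ->
  Q \in principal F -> exists2 G, G \is (q - r).-homog & Q = F * G.
Proof.
move=> homF homQ /principalP[G eQ].
have := pihomog_mull q G homF; rewrite -eQ pihomog_dE //; case: leqP => _ ->.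
  by exists (pihomog mdeg (q - r) G); first exact: pihomogP.
by exists 0; rewrite ?rpred0 ?mulr0.
Qed.

Lemma principal_homogeneous r F : F \is r.-homog -> homogeneous (principal F).
Proof.
move=> homF _ /principalP[G ->] k; apply/principalP.
rewrite (pihomog_mull _ _ homF); case: ifP => _; last by exists 0; rewrite mulr0.
by exists (pihomog mdeg (k - r) G).
Qed.

Lemma homog_mnm2 i j : ('X_[mnm2 i j] : {mpoly K[2]}) \is (i + j).-homog.
Proof. by rewrite dhomogX /= mdeg_mnm2. Qed.

Lemma mpolyX_mnm2_neq0 i j : ('X_[mnm2 i j] : {mpoly K[2]}) != 0.
Proof. by rewrite -(dehom_eq0 (homog_mnm2 i j)) dehomX -size_poly_eq0 size_polyXn. Qed.

Lemma principal_homog_saturated r q n F Q : F \is r.-homog -> F != 0 ->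
  Q \is q.-homog ->
  'X_[mnm2 n 0] * Q \in principal F -> 'X_[mnm2 0 n] * Q \in principal F ->
  exists2 C, C \is (q - r).-homog & Q = F * C.
Proof.
move=> homF nzF homQ inA inB.
have homA := dhomogM (homog_mnm2 n 0) homQ; rewrite addn0 in homA.
case: (leqP r (n + q)) => [lern|gtr].
  have [A hA eA] := homog_principalP homF homA inA.
  have /principalP[B eB] := inB.
  exact: (mull_descent homF homQ nzF lern hA eA eB).
(* Here X_0^n Q is a multiple of F of degree less than [r], hence 0, and so Q = 0. *)
have /principalP[A eA] := inA; exists 0; first exact: rpred0.
have := pihomog_mull (n + q) A homF; rewrite -eA pihomog_dE // leqNgt gtr /=.
by move/eqP; rewrite mulf_eq0 (negPf (mpolyX_mnm2_neq0 n 0)) mulr0 => /eqP.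
Qed.

(** By homogeneity of the ideal, the hypothesis passes to each homogeneous component of Q, where the
    multipliers X_0^n and X_1^n suffice. *)
Lemma principal_saturated r F : F \is r.-homog -> F != 0 -> saturated (principal F).
Proof.
move=> homF nzF Q [n inI].
have hn0 : ('X_[mnm2 n 0] : {mpoly K[2]}) \is n.-homog.
  by have := homog_mnm2 n 0; rewrite addn0.
have piece k : exists C, pihomog mdeg k Q = F * C.
  have sub M : M \is n.-homog -> M * pihomog mdeg k Q \in principal F.
    move=> homM; have := principal_homogeneous homF (inI _ homM) (n + k).
    by rewrite (pihomog_mull _ _ homM) leq_addr addKn.
  have [] := @principal_homog_saturated r k n _ _ homF nzF (pihomogP mdeg k Q).
  - exact: sub.
  - by apply: sub; exact: (homog_mnm2 0 n).
  - by move=> C _ eC; exists C.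
apply/principalP; rewrite (pihomog_partitionE (leqnn (mmeasure mdeg Q))).
elim/big_ind: _ => [|_ _ [C ->] [D ->]|k _].
- by exists 0; rewrite mulr0.
- by exists (C + D); rewrite mulrDr.
- exact: piece.
Qed.

Lemma principal_idealr_closed F : 1 \notin principal F -> idealr_closed (principal F).
Proof.
move=> notin1; split => // [|a _ _ /principalP[G ->] /principalP[G' ->]]; apply/principalP.
  by exists 0; rewrite mulr0.
by exists (a * G + G'); rewrite mulrDr mulrCA.
Qed.

Section MulForm.
Context (r k : nat) (F : {mpoly K[2]}) (homF : F \is r.-homog) (lerk : (r <= k)%N).

Lemma mul_form_dhomog (G : dhomog 2 K (k - r)) : F * G \is k.-homog.
Proof. by have := dhomogM homF (dhomog_is_dhomog G); rewrite subnKC. Qed.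

Definition mul_form (G : dhomog 2 K (k - r)) : dhomog 2 K k := DHomog (mul_form_dhomog G).

Lemma mul_form_is_linear : linear mul_form.
Proof. by move=> c G1 G2; apply: val_inj; rewrite /= mulrDr scalerAr. Qed.
HB.instance Definition _ :=
  GRing.isLinear.Build K (dhomog 2 K (k - r)) (dhomog 2 K k) _ mul_form mul_form_is_linear.

Lemma principal_graded_piece : graded_piece (principal F) (limg (linfun mul_form)).
Proof.
move=> Q; apply/memv_imgP/idP => [[G _ ->]|].
  by rewrite lfunE; apply/principalP; exists G.
move=> /(homog_principalP homF (dhomog_is_dhomog Q))[G homG eQ].
by exists (DHomog homG); rewrite ?memvf // lfunE; exact: val_inj.
Qed.

Lemma dim_principal_piece : F != 0 -> \dim (limg (linfun mul_form)) = (k - r).+1.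
Proof.
move=> nzF; rewrite limg_dim_eq ?dim_dhomog2 // capfv; apply/eqP/lker0P => G1 G2.
by rewrite !lfunE => /(congr1 val) /(mulfI nzF) /val_inj.
Qed.
End MulForm.

(** Multiplication by F is injective, so the codimension in degree k >= r is (k + 1) - (k - r + 1) =
    r. *)
Lemma principal_scheme_length r F :
  F \is r.-homog -> F != 0 -> scheme_length (principal F) r.
Proof.
move=> homF nzF; exists r => k lerk.
exists (limg (linfun (mul_form homF lerk))); first exact: principal_graded_piece.
rewrite /quotv dimvf /dim /= dimv_compl dim_dhomog2 dim_principal_piece //; lia.
Qed.
End PrincipalIdeals.

(** * Chains of iterates inside a subspace *)

Section ShiftChains.
Context (K : fieldType) (V : vectType K).

(* W :&: f^-1(W) again satisfies the hypothesis on dimensions, and its dimension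
   drops by at most one. *)
Lemma shift_chain (f : 'End(V)) m (W : {vspace V}) :
  (W :&: lker f = 0)%VS -> (\dim (W + f @: W) <= (\dim W).+1)%N ->
  (m < \dim W)%N ->
  exists2 h, h != 0 & forall i, (i <= m)%N -> iter i f h \in W.
Proof.
elim: m W => [|m IHm] W injW dimW ltm.
  exists (vpick W); first by rewrite vpick0 -dimv_eq0 -lt0n.
  by move=> i; rewrite leqn0 => /eqP->; exact: memv_pick.
pose U := (W :&: f @^-1: W)%VS.
have sUW : (U <= W)%VS by exact: capvSl.
have injU : (U :&: lker f = 0)%VS.
  by apply/eqP; rewrite -subv0 -injW capvS.
have sfU : (f @: U <= W)%VS.
  apply/subvP=> _ /memv_imgP[u uU ->]; move: uU.
  by rewrite memv_cap => /andP[_]; rewrite memv_preim.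
have sWfU : (W :&: f @: W <= f @: U)%VS.
  apply/subvP=> w; rewrite memv_cap => /andP[wW /memv_imgP[u uW ew]].
  by rewrite ew memv_img // memv_cap uW -memv_preim -ew.
(* As [f] is injective on [W], dim(W ∩ f W) = 2 dim W - dim(W + f W) >= dim W - 1, and this bounds
   dim U from below. *)
have := dimvS sWfU; rewrite (limg_dim_eq injU) => leU.
have := dimv_sum_cap W (f @: W)%VS; rewrite (limg_dim_eq injW) => eqW.
have ltU : (m < \dim U)%N by lia.
have dimU : (\dim (U + f @: U) <= (\dim U).+1)%N.
  have : (U + f @: U <= W)%VS by rewrite subv_add sUW.
  by move/dimvS; lia.
(* A chain in [U] gains one more term in [W], because [f] maps [U] into [W]. *)
have [h nzh inU] := IHm U injU dimU ltU; exists h => // -[|i] lei.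
  exact: subvP sUW _ (inU 0%N _).
by rewrite iterS; apply: (subvP sfU); rewrite memv_img // inU.
Qed.
End ShiftChains.

(** * A form of degree [n] in a saturated ideal of length [n] *)

Section LowDegreeForm.
Context (K : fieldType).
Implicit Types (I : {pred {mpoly K[2]}}).

(** With [N] independent of [k], forms of consecutive degrees share one row space, in which
    multiplication by X_1 is the inclusion. *)
Definition dehom_row N k (Q : dhomog 2 K k) : 'rV[K]_N := poly_rV (dehom Q).

Lemma dehom_row_is_linear N k : linear (@dehom_row N k).
Proof.
by move=> c Q1 Q2; rewrite /dehom_row /= rmorphD /= dehomZ linearP.
Qed.
HB.instance Definition _ N k :=
  GRing.isLinear.Build K (dhomog 2 K k) 'rV[K]_N _ (@dehom_row N k)
    (@dehom_row_is_linear N k).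

(** Corresponds to multiplication by X_0, but [poly_rV] cuts off degree [N]: it is faithful on
    polynomials of size less than [N]. *)
Definition shift_row N (v : 'rV[K]_N) : 'rV[K]_N := poly_rV ('X * rVpoly v).

Lemma shift_row_is_linear N : linear (@shift_row N).
Proof. by move=> c u v; rewrite /shift_row linearP mulrDr -scalerAr linearP. Qed.
HB.instance Definition _ N :=
  GRing.isLinear.Build K 'rV[K]_N 'rV[K]_N _ (@shift_row N) (@shift_row_is_linear N).

Lemma idealr_mull I a Q : idealr_closed I -> Q \in I -> a * Q \in I.
Proof. by case=> I0 _ hI QI; rewrite -[_ * _]addr0 hI. Qed.

Lemma idealr_add I Q1 Q2 : idealr_closed I -> Q1 \in I -> Q2 \in I -> Q1 + Q2 \in I.
Proof. by case=> _ _ hI Q1I Q2I; rewrite -[Q1]mul1r hI. Qed.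

Lemma saturated_form I (n : nat) : idealr_closed I -> saturated I -> scheme_length I n ->
  exists H, [/\ H != 0, H \is n.-homog & H \in I].
Proof.
(* In degree k0 + n, codimension [n] means dimension k0 + 1: a chain h, ..., x^k0 h, one term for
   each monomial of degree [k0]. *)
move=> idI satI [k0 hilbI]; pose k := (k0 + n)%N.
have [W gradW dimW] := hilbI k (leq_addr _ _).
have [W1 gradW1 dimW1] := hilbI k.+1 (leqW (leq_addr _ _)).
have ek : k = (k0 + n)%N by [].
clearbody k.
move: dimW dimW1; rewrite /quotv !dimvf /dim /= !dimv_compl !dim_dhomog2 => dimW dimW1.
have leW : (\dim W <= k.+1)%N by rewrite -(dim_dhomog2 K k) dimvS ?subvf.
have leW1 : (\dim W1 <= k.+2)%N by rewrite -(dim_dhomog2 K k.+1) dimvS ?subvf.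
pose phi : 'Hom(dhomog 2 K k, 'rV[K]_k.+2) := linfun (@dehom_row k.+2 k).
pose phi1 : 'Hom(dhomog 2 K k.+1, 'rV[K]_k.+2) := linfun (@dehom_row k.+2 k.+1).
pose f : 'End('rV[K]_k.+2) := linfun (@shift_row k.+2).
have rVphi (Q : dhomog 2 K k) : rVpoly (phi Q) = dehom Q.
  by rewrite lfunE /= poly_rV_K // ltnW // ltnS size_dehom ?dhomog_is_dhomog.
have rVf v : (size (rVpoly v) <= k.+1)%N -> rVpoly (f v) = 'X * rVpoly v.
  move=> sv; rewrite lfunE /= poly_rV_K // (leq_trans (size_polyMleq _ _)) //.
  by rewrite size_polyX.
have size_phi v : v \in (phi @: W)%VS -> (size (rVpoly v) <= k.+1)%N.
  by case/memv_imgP=> Q _ ->; rewrite rVphi size_dehom ?dhomog_is_dhomog.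
have kerf : (phi @: W :&: lker f = 0)%VS.
  apply/eqP; rewrite -subv0; apply/subvP=> v; rewrite memv_cap memv_ker memv0.
  case/andP=> /size_phi sv /eqP fv0; have := rVf v sv.
  rewrite fv0 linear0 => /esym/eqP; rewrite mulf_eq0 polyX_eq0 /= => /eqP v0.
  by rewrite -[v]rVpolyK v0 linear0.
have injphi : (W :&: lker phi = 0)%VS.
  apply/eqP; rewrite -subv0; apply/subvP=> Q; rewrite memv_cap memv_ker memv0.
  case/andP=> _ /eqP e; have := rVphi Q; rewrite e linear0 => /esym/eqP.
  by rewrite (dehom_eq0 (dhomog_is_dhomog Q)).
have dimphi : \dim (phi @: W) = \dim W by exact: limg_dim_eq.
(* Multiplying by X_1 keeps the row of a form and multiplying by X_0 shifts it; both products stay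
   in the ideal. *)
have sub : (phi @: W + f @: (phi @: W) <= phi1 @: W1)%VS.
  have lift i j v (Q : dhomog 2 K k) : (i + j = 1)%N -> Q \in W ->
      rVpoly v = 'X^i * dehom Q -> v \in (phi1 @: W1)%VS.
    move=> ij QW ev.
    have hom1 : 'X_[mnm2 i j] * (Q : {mpoly K[2]}) \is k.+1.-homog.
      by have := dhomogM (homog_mnm2 K i j) (dhomog_is_dhomog Q); rewrite ij.
    apply/memv_imgP; exists (DHomog hom1).
      by rewrite gradW1 /=; apply: idealr_mull => //; rewrite -gradW.
    by rewrite lfunE /= /dehom_row /= rmorphM /= dehomX -ev rVpolyK.
  rewrite subv_add; apply/andP; split; apply/subvP.
    by move=> _ /memv_imgP[Q QW ->]; apply: (lift 0%N 1%N _ Q); rewrite // rVphi mul1r.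
  move=> _ /memv_imgP[_ /memv_imgP[Q QW ->] ->]; apply: (lift 1%N 0%N _ Q) => //.
  by rewrite rVf ?rVphi // size_dehom ?dhomog_is_dhomog.
have dimf : (\dim (phi @: W + f @: (phi @: W)) <= (\dim (phi @: W)).+1)%N.
  apply: leq_trans (dimvS sub) _; rewrite dimphi.
  apply: (@leq_trans (\dim W1)); last by lia.
  by rewrite -(limg_ker_dim phi1 W1) leq_addl.
have ltk : (k0 < \dim (phi @: W))%N by lia.
have [h nzh inW] := shift_chain kerf dimf ltk.
have rVh i : (i <= k0)%N -> rVpoly (iter i f h) = 'X^i * rVpoly h.
  elim: i => [|i IHi] lei; first by rewrite mul1r.
  rewrite iterS rVf; first by rewrite IHi ?(ltnW lei) // exprS mulrA.
  by apply: size_phi; apply: inW; exact: ltnW.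
have nzp : rVpoly h != 0.
  by apply: contraNneq nzh => p0; rewrite -[h]rVpolyK p0 linear0.
(* The last term x^k0 h still has degree at most k = k0 + n. *)
have sh : (size (rVpoly h) <= n.+1)%N.
  have := size_phi _ (inW k0 (leqnn _)).
  by rewrite rVh // mulrC size_mulXn //; lia.
exists (rehom n (rVpoly h)); have homH := rehom_dhomog n (rVpoly h); split => //.
  by rewrite -(dehom_eq0 homH) rehomK.
(* Saturation is applied with exponent [k0]: X_0^i X_1^(k0-i) times the form dehomogenizes to x^i h,
   a term of the chain. *)
apply: satI; exists k0 => M homM; rewrite -(dehomK homM) /rehom mulr_suml.
elim/big_ind: _ => [||i _]; [by case: idI | by move=> ? ?; exact: idealr_add |].
rewrite -mul_mpolyC -mulrA; apply: idealr_mull => //.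
have lei : (i <= k0)%N by rewrite -ltnS.
have /memv_imgP[Q QW eQ] := inW i lei.
have -> : 'X_[mnm2 i (k0 - i)] * rehom n (rVpoly h) = Q.
  have homX : ('X_[mnm2 i (k0 - i)] : {mpoly K[2]}) \is k0.-homog.
    by have := homog_mnm2 K i (k0 - i); rewrite subnKC.
  have homQ : (Q : {mpoly K[2]}) \is (k0 + n).-homog.
    by rewrite -ek; exact: dhomog_is_dhomog.
  apply: (dehom_inj (dhomogM homX homH) homQ).
  by rewrite rmorphM /= dehomX rehomK // -rVh // eQ rVphi.
by rewrite -gradW.
Qed.
End LowDegreeForm.

(** * The cactus rank as the least degree of an apolar form *)

Section CactusRank.
Context (K : numFieldType) (l : nat) (P : dhomog 2 K l).
Implicit Types (F G Q : {mpoly K[2]}).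

(** By linearity this reduces to monomials, where partial derivatives compose; it makes [Ann P] an
    ideal. *)
Lemma contractM (p : {mpoly K[2]}) G F :
  contract p (G * F) = contract (contract p F) G.
Proof.
rewrite (mpolyE G) mulr_suml [LHS]linear_sum [RHS]linear_sum /=.
apply: eq_bigr => m _; rewrite -scalerAl [LHS]linearZ [RHS]linearZ /=; congr (_ *: _).
rewrite contractX {1}(mpolyE F) mulr_sumr [LHS]linear_sum /=.
rewrite [in RHS](mpolyE F) [contract p _]linear_sum [RHS]linear_sum /=.
apply: eq_bigr => m' _; rewrite -scalerAr [LHS]linearZ [contract p _]linearZ [RHS]linearZ /=.
by rewrite -mpolyXD !contractX addmC mderivmDm.
Qed.

Lemma ann_mull Q G : Q \in Ann P -> G * Q \in Ann P.
Proof.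
rewrite !inE => /eqP QP0; apply/eqP; rewrite -/(contract P _) contractM.
rewrite [contract P Q]QP0 /contract /apolar big1 // => m _.
by rewrite linear0 scaler0.
Qed.

Lemma ann_principal F : F \in Ann P -> {subset principal F <= Ann P}.
Proof. by move=> annF _ /principalP[G ->]; rewrite mulrC ann_mull. Qed.

(** Provides a nonzero apolar form, so that the minimum defining [crank] is over a nonempty set. *)
Lemma ann_high_power : 'X_[mnm2 l.+1 0] \in Ann P.
Proof.
rewrite inE -/(contract P _) contractX; apply/eqP/mpolyP=> m.
rewrite mcoeff_mderivm mcoeff0 (dhomog_nemf_coeff (dhomog_is_dhomog P)) ?mul0rn //.
by rewrite /= mdegD mdeg_mnm2 addn0 addSn gtn_eqF // ltnS leq_addr.
Qed.

Hypothesis nzP : P != 0.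

Lemma one_notin_ann : 1 \notin Ann P.
Proof.
rewrite inE -/(contract P _) -mpolyX0 contractX mderivm0m.
by apply: contra nzP => /eqP P0; apply/eqP/val_inj.
Qed.

(** [saturated_form] gives one direction. For the other, [principal F] is the required ideal, proper
    because 1 does not annihilate P. *)
Lemma apolar_schemeP n : apolar_scheme P n <->
  exists F, [/\ F != 0, F \is n.-homog & F \in Ann P].
Proof.
split=> [[I [idI homI satI subI lenI]]|[F [nzF homF annF]]].
  have [F [nzF homF inI]] := saturated_form idI satI lenI.
  by exists F; split => //; exact: subI.
have sub := ann_principal annF; exists (principal F); split => //.
- by apply: principal_idealr_closed; apply: contra one_notin_ann; exact: sub.
- exact: principal_homogeneous homF.
- exact: principal_saturated homF nzF.
- exact: principal_scheme_length homF nzF.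
Qed.

Lemma crank_min n Q : Q \is n.-homog -> Q != 0 -> Q \in Ann P -> (crank P <= n)%N.
Proof.
move=> homQ nzQ annQ; rewrite /crank; case: pselect => // ex.
by case: ex_minnP => m _; apply; apply/asboolP/apolar_schemeP; exists Q.
Qed.

Lemma crank_form : exists F, [/\ F != 0, F \is (crank P).-homog & F \in Ann P].
Proof.
have homX := homog_mnm2 K l.+1 0.
rewrite /crank; case: pselect => [ex|[]].
  by case: ex_minnP => m /asboolP/apolar_schemeP.
exists (l.+1 + 0)%N; apply/asboolP/apolar_schemeP.
by exists 'X_[mnm2 l.+1 0]; rewrite mpolyX_mnm2_neq0 ann_high_power homX.
Qed.

(** A nonzero form of degree 0 is a unit, and [Ann P] is a proper ideal. *)
Lemma crank_gt0 : (0 < crank P)%N.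
Proof.
rewrite lt0n; apply/negP=> /eqP r0; have [F [nzF homF annF]] := crank_form.
rewrite r0 in homF.
have eF : F = F@_(mnm2 0 0) *: 1.
  apply: (dehom_inj homF); first by apply: rpredZ; exact: dhomog1.
  rewrite dehomZ rmorph1 -(coef_dehom homF) // alg_polyC.
  by apply: size1_polyC; exact: size_dehom.
move: one_notin_ann; rewrite -(scale1r 1) -(@mulVf K F@_(mnm2 0 0)).
  by rewrite -scalerA -eF -mul_mpolyC ann_mull.
by apply: contraNneq nzF => c0; rewrite eF c0 scale0r.
Qed.

Local Notation rho d := (\rank (hankel (moment l P) d.+1 (l - d).+1)).

Lemma rank_hankel_sym d : (d <= l)%N -> rho (l - d) = rho d.
Proof. by move=> led; rewrite rank_hankelC subKn. Qed.

Lemma rank_hankel_low d : (d <= l)%N -> (d < crank P)%N -> rho d = d.+1.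
Proof.
move=> led ltd; apply/eqP; rewrite eqn_leq rank_leq_row -subn_eq0.
rewrite -(dim_lker_apolar P led) dimv_eq0 -subv0; apply/subvP=> Q.
rewrite lker_apolar_map memv0; apply: contraTT => nzQ; apply/negP=> annQ.
by have := crank_min (dhomog_is_dhomog Q) nzQ annQ; rewrite leqNgt ltd.
Qed.

Lemma rank_hankel_mid d :
  (crank P <= d)%N -> (d + crank P <= l.+1)%N -> rho d = crank P.
Proof.
move=> lerd ledr; have r_gt0 := crank_gt0; have [F [nzF homF annF]] := crank_form.
set r := crank P in r_gt0 homF lerd ledr *.
have sub k (lerk : (r <= k)%N) :
    (limg (linfun (mul_form homF lerk)) <= lker (linfun (@apolar_map K l P k)))%VS.
  apply/subvP=> Q; rewrite (principal_graded_piece homF lerk) lker_apolar_map.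
  exact: ann_principal.
(* The largest degree allowed for [d]. Since l - D = r - 1 is below [r], symmetry gives rank [r] in
   degree [D], which leaves a kernel no larger than the multiples of F. *)
pose D := (l.+1 - r)%N; have leD : (D <= l)%N by lia.
have lerD : (r <= D)%N by lia.
have dimD : \dim (lker (linfun (@apolar_map K l P D))) = (D - r).+1.
  rewrite dim_lker_apolar // -rank_hankel_sym // rank_hankel_low; lia.
have eqD : limg (linfun (mul_form homF lerD)) = lker (linfun (@apolar_map K l P D)).
  by apply/eqP; rewrite eqEdim sub dimD (dim_principal_piece homF lerD nzF) leqnn.
have annD Q : Q \is D.-homog -> Q \in Ann P -> Q \in principal F.
  move=> homQ annQ.
  have : DHomog homQ \in lker (linfun (@apolar_map K l P D)) by rewrite lker_apolar_map.
  by rewrite -eqD (principal_graded_piece homF lerD).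
have led : (d <= l)%N by lia.
have eqd : limg (linfun (mul_form homF lerd)) = lker (linfun (@apolar_map K l P d)).
  apply/eqP; rewrite eqEsubv sub; apply/subvP=> Q.
  rewrite lker_apolar_map (principal_graded_piece homF lerd) => annQ.
  have homQ := dhomog_is_dhomog Q; have leDd : (D - d + d)%N = D by lia.
  have mon i j : (i + j = D - d)%N -> 'X_[mnm2 i j] * (Q : {mpoly K[2]}) \in principal F.
    move=> ij; apply: annD; last exact: ann_mull.
    by have := dhomogM (homog_mnm2 K i j) homQ; rewrite ij leDd.
  have [||C _ ->] := principal_homog_saturated (n := (D - d)%N) homF nzF homQ.
  - by apply: mon; rewrite addn0.
  - exact: mon.
  - by apply/principalP; exists C.
have := dim_principal_piece homF lerd nzF; rewrite eqd dim_lker_apolar //.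
by have := rank_leq_row (hankel (moment l P) d.+1 (l - d).+1); lia.
Qed.

(** In degree [l/2] + 1 the Hankel matrix has more rows than columns, so its rows cannot be
    independent. *)
Lemma crank_le : (crank P <= l %/ 2 + 1)%N.
Proof.
rewrite leqNgt; apply/negP=> gtr; case: (leqP (l %/ 2 + 1) l) => [led|gtd].
  have := rank_hankel_low led gtr.
  by have := rank_leq_col (hankel (moment l P) (l %/ 2 + 1).+1 (l - (l %/ 2 + 1)).+1); lia.
(* Only [l = 0] is left, where X_0 itself is apolar. *)
have homX := homog_mnm2 K l.+1 0.
have := crank_min homX (mpolyX_mnm2_neq0 _ _ _) ann_high_power; lia.
Qed.

Lemma dim_coker_low d : (d <= l)%N -> (d < crank P)%N ->
  \dim {: apolar_coker P d} = (l - 2 * d)%N.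
Proof. by move=> led ltd; rewrite dim_apolar_coker // rank_hankel_low //; lia. Qed.

(** Truncated subtraction also covers the surjective range: if d + crank P > l + 1, the rank is l -
    d + 1 by symmetry and both sides are 0. *)
Lemma dim_coker_mid d : (d <= l)%N -> (crank P <= d)%N ->
  \dim {: apolar_coker P d} = (l - d + 1 - crank P)%N.
Proof.
move=> led lerd; rewrite dim_apolar_coker //; case: (leqP (d + crank P) l.+1) => [le|gt].
  by rewrite rank_hankel_mid // addn1.
have lt : (l - d < crank P)%N by lia.
by rewrite -rank_hankel_sym // rank_hankel_low ?leq_subr //; lia.
Qed.
End CactusRank.

(** * The case formulas for the dimension of the cokernel *)

Theorem proposition3p8 (R : realType) (l : nat) :
  (forall (P : dhomog 2 R[i] l) (d : nat), P != 0 -> (d <= l)%N ->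
     let r := crank P in
     let s := \dim {: apolar_coker P d} in
     [/\ l%:Z + 2 - r%:Z <= d%:Z -> s%:Z = 0,
         r%:Z <= d%:Z -> d%:Z < l%:Z + 2 - r%:Z ->
           s%:Z = l%:Z - d%:Z + 1 - r%:Z
       & d%:Z < r%:Z -> s%:Z = l%:Z - 2 * d%:Z])
  /\
  (exists s : nat -> nat -> nat,
     [/\ forall (P : dhomog 2 R[i] l) (d : nat), P != 0 -> (d <= l)%N ->
           (1 <= crank P <= l %/ 2 + 1)%N /\
           \dim {: apolar_coker P d} = s d (crank P),
         forall d r : nat, (d <= l %/ 2)%N ->
           ((1 <= r <= d + 1)%N ->
              (s d r)%:Z = l%:Z - d%:Z - (r%:Z - 1)) /\
           ((d + 1 <= r <= l %/ 2 + 1)%N -> (s d r)%:Z = l%:Z - 2 * d%:Z)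
       & forall d r : nat, (l %/ 2 <= d <= l)%N ->
           ((1 <= r <= l - d + 1)%N ->
              (s d r)%:Z = l%:Z - d%:Z - (r%:Z - 1)) /\
           ((l - d + 1 <= r <= l %/ 2 + 1)%N -> (s d r)%:Z = 0)]).
Proof.
have rank_bounds (P : dhomog 2 R[i] l) : P != 0 -> (1 <= crank P <= l %/ 2 + 1)%N.
  by move=> nzP; rewrite (crank_gt0 nzP) (crank_le nzP).
split=> [P d nzP led r s|].
  (* The bound r <= [l/2] + 1 gives l - 2d >= 0 when [d < r] and makes the first and third cases
     disjoint. *)
  have := rank_bounds P nzP; rewrite -/r => /andP[r_gt0 ler].
  have low : (d < r)%N -> s = (l - 2 * d)%N by exact: dim_coker_low.
  have mid : (r <= d)%N -> s = (l - d + 1 - r)%N by exact: dim_coker_mid.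
  by clearbody r s; clear rank_bounds; split; lia.
(* The two formulas agree at r = d + 1. From the middle degree on, truncation yields the value 0 for
   r >= l - d + 1. *)
exists (fun d r => if (r <= d + 1)%N || (l %/ 2 <= d)%N then (l - d + 1 - r)%N
                   else (l - 2 * d)%N).
split=> [P d nzP led|d r led|d r /andP[ged led]].
- split; first exact: rank_bounds.
  have /andP[r_gt0 ler] := rank_bounds P nzP.
  case: (leqP (crank P) d) => [lerd|ltd].
    by rewrite dim_coker_mid // (leq_trans lerd) // leq_addr.
  by rewrite dim_coker_low //; move: (crank P) ltd ler => r ltd ler; case: ifP; lia.
- by clear rank_bounds; case: ifP; lia.
- by clear rank_bounds; rewrite ged orbT; lia.
Qed.
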